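(* Let $R\in\mathbb{R}^{2n,2n}$ be a nonsingular upper triangular matrix, and let $L=R^T=(L_1,\ldots,L_n)$ with $L_j=(L_{j1},L_{j2})\in\mathbb{R}^{2n,2}$. For $j=1,\ldots,n$ put $\beta_j=\sqrt[4]{\det(L_j^TL_j)}$, and let $$\beta=\max_{j=1,\ldots,n}\beta_j,\qquad \gamma=\min_{j=1,\ldots,n}\beta_j .$$ Let $\widetilde{D}_r=\operatorname{diag}(\widetilde{D}_1,\ldots,\widetilde{D}_n)$, where for $j=1,\ldots,n$ $$\widetilde{D}_j=\begin{pmatrix}\tilde c_{jj}&\tilde f_{jj}\\0&\tilde c_{jj}^{-1}\end{pmatrix},\qquad \tilde c_{jj}=\frac{\|L_{j2}\|_2}{\beta},\qquad \tilde f_{jj}=\frac{-L_{j1}^TL_{j2}\pm\sqrt{\beta^4-\beta_j^4}}{\beta\,\|L_{j2}\|_2}$$ (with either choice of sign for each $j$). Then $$\min_{D\in\mathcal{D}}\kappa_2(DR)\le\kappa_2(\widetilde{D}_rR)\le\sqrt{2n}\;\frac{\beta\sqrt{\beta^2+\sqrt{\beta^4-\gamma^4}}}{\gamma^2}\;\min_{D\in\mathcal{D}}\kappa_2(DR).$$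
   Context: $\kappa_2$ denotes the spectral condition number $\kappa_2(X)=\|X\|_2\|X^{-1}\|_2$. $\mathcal{D}$ is the set of all real $2n\times 2n$ block diagonal matrices $D=\operatorname{diag}(D_1,\ldots,D_n)$ whose $2\times2$ diagonal blocks have the form $D_j=\begin{pmatrix}c_{jj}&f_{jj}\\0&c_{jj}^{-1}\end{pmatrix}$ with $c_{jj}\in\mathbb{R}\setminus\{0\}$, $f_{jj}\in\mathbb{R}$. $L_j^T\in\mathbb{R}^{2,2n}$ is the $j$th block row of $R$, i.e. rows $2j-1$ and $2j$ of $R$; $L_{j1}$ and $L_{j2}$ are the two columns of $L_j$. *)

(* Defs.v *)
From HB Require Import structures.
From mathcomp Require Import all_boot all_order all_algebra.
From mathcomp Require Import all_classical reals exp.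

Set Implicit Arguments.
Unset Strict Implicit.
Unset Printing Implicit Defensive.

Import Order.TTheory GRing.Theory Num.Theory.

Local Open Scope classical_set_scope.
Local Open Scope ring_scope.

(* The order 2n is written as a sum of n copies of 2, which is the shape that
   the library's operators \mxdiag and submxcol for block matrices expect. *)
Definition twon (n : nat) : nat := (\sum_(j < n) 2)%N.

Lemma twonE (n : nat) : twon n = (2 * n)%N.
Proof. by rewrite /twon big_const_ord iter_addn addn0. Qed.

(* Euclidean norm; the library's norm on matrices is the max norm. *)
Definition norm2 (K : realType) (m : nat) (v : 'cV[K]_m) : K :=
  Num.sqrt (\sum_(i < m) v i 0 ^+ 2).

Definition dot (K : realType) (m : nat) (u v : 'cV[K]_m) : K :=
  (u^T *m v) 0 0.

(* The operator norm induced by the Euclidean norm. *)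
Definition mxnorm2 (K : realType) (p m : nat) (A : 'M[K]_(p, m)) : K :=
  sup [set norm2 (A *m v) | v in [set v : 'cV[K]_m | norm2 v = 1]].

Definition kappa2 (K : realType) (m : nat) (A : 'M[K]_m) : K :=
  mxnorm2 A * mxnorm2 (invmx A).

Definition upper_triangular (K : realType) (m : nat) (A : 'M[K]_m) : bool :=
  is_trig_mx A^T.

Definition Dblock (K : realType) (c f : K) : 'M[K]_2 :=
  block_mx (c%:M : 'M[K]_1) (f%:M : 'M[K]_1) (0 : 'M[K]_1) ((c^-1)%:M : 'M[K]_1).

Definition blockdiag (K : realType) (n : nat) (c f : 'I_n -> K) :
    'M[K]_(twon n) :=
  \mxdiag_(j < n) Dblock (c j) (f j).

Definition calD (K : realType) (n : nat) : set ('M[K]_(twon n)) :=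
  [set D | exists c f : 'I_n -> K,
     (forall j, c j != 0) /\ D = blockdiag c f].

Section Blocks.
Variables (K : realType) (n : nat) (R : 'M[K]_(twon n)).

Definition Lblock (j : 'I_n) : 'M[K]_(twon n, 2) :=
  (@submxcol K n (fun=> 2%N) (twon n) R j)^T.

Lemma LblockE (j : 'I_n) (i : 'I_(twon n)) (k : 'I_2) (r : 'I_(twon n)) :
  r = (2 * j + k)%N :> nat -> Lblock j i k = R r i.
Proof.
move=> rE; rewrite /Lblock !mxE; congr (R _ _); apply: val_inj.
have := @tagnat.RankEsum n (fun=> 2%N) j k.
by rewrite -(big_ord_widen n (fun=> 2%N)) 1?ltnW // big_const_ord iter_addn addn0 -rE.
Qed.

Definition L1 (j : 'I_n) : 'cV[K]_(twon n) := col 0 (Lblock j).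
Definition L2 (j : 'I_n) : 'cV[K]_(twon n) := col 1 (Lblock j).

Definition beta_ (j : 'I_n) : K :=
  (\det ((Lblock j)^T *m Lblock j)) `^ 4^-1.

(* The beta_ j are nonnegative and at most beta, so when n > 0 the initial
   values 0 and beta do not affect these extrema. *)
Definition beta : K := \big[Num.max/0]_(j < n) beta_ j.
Definition gamma : K := \big[Num.min/beta]_(j < n) beta_ j.

Definition ctilde (j : 'I_n) : K := norm2 (L2 j) / beta.

(* s j = true selects the minus sign. *)
Definition ftilde (s : 'I_n -> bool) (j : 'I_n) : K :=
  (- dot (L1 j) (L2 j)
     + (-1) ^+ s j * Num.sqrt (beta ^+ 4 - beta_ j ^+ 4))
  / (beta * norm2 (L2 j)).

Definition Dtilde (s : 'I_n -> bool) : 'M[K]_(twon n) :=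
  blockdiag ctilde (ftilde s).

End Blocks.

(* Main.v *)
(* Every block row of Dtilde R has Gram matrix [[beta^2, s_j], [s_j, beta^2]]
   with s_j^2 = beta^4 - beta_j^4, so its eigenvalues lie between beta^2 - tau
   and beta^2 + tau <= 2 beta^2, where tau^2 = beta^4 - gamma^4. The upper bound
   gives |Dtilde R| <= sqrt(2n) beta. For D in the class, the lower bound
   applied to the blocks of (D Dtilde^-1)^T gives
     |D Dtilde^-1| sqrt(beta^2 - tau) <= |D R|,
   and (Dtilde R)^-1 = (D R)^-1 (D Dtilde^-1) yields the second inequality,
   since 1 / sqrt(beta^2 - tau) = sqrt(beta^2 + tau) / gamma^2.
   The minimum is attained because kappa2 (D R) <= kappa2 R bounds the entries
   of D and of its inverse: |D^-1| >= 1 as the blocks have determinant 1. *)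
Require Import Defs.
From HB Require Import structures.
From mathcomp Require Import all_boot all_order all_algebra.
From mathcomp Require Import all_classical reals exp.
From mathcomp Require Import topology normedtype derive.
From mathcomp Require Import ring lra.

Import Order.TTheory GRing.Theory Num.Theory.
Import numFieldNormedType.Exports.

Local Open Scope classical_set_scope.
Local Open Scope ring_scope.

(** * Euclidean norm, operator norm, and continuity of seminorms *)

Section Euclidean.
Context {K : realType}.
Implicit Types (m p q : nat).

Lemma dotE {m} (u v : 'cV[K]_m) : dot u v = \sum_i u i 0 * v i 0.
Proof. by rewrite /dot mxE; apply: eq_bigr => i _; rewrite mxE. Qed.

Lemma dotC {m} (u v : 'cV[K]_m) : dot u v = dot v u.
Proof. by rewrite !dotE; apply: eq_bigr => i _; rewrite mulrC. Qed.

Lemma dot_mull {m p} (A : 'M[K]_(p, m)) u v :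
  dot (A *m u) v = dot u (A^T *m v).
Proof. by rewrite /dot trmx_mul -mulmxA. Qed.

Lemma norm2_ge0 {m} (v : 'cV[K]_m) : 0 <= norm2 v.
Proof. exact: sqrtr_ge0. Qed.

Lemma norm2_sqr {m} (v : 'cV[K]_m) : norm2 v ^+ 2 = dot v v.
Proof.
rewrite sqr_sqrtr ?dotE; last by apply: sumr_ge0 => i _; exact: sqr_ge0.
by apply: eq_bigr => i _; rewrite expr2.
Qed.

Lemma norm2_le {m p} (u : 'cV[K]_m) (v : 'cV[K]_p) :
  (norm2 u <= norm2 v) = (dot u u <= dot v v).
Proof. by rewrite -!norm2_sqr ler_sqr ?nnegrE ?norm2_ge0. Qed.

Lemma norm2_eq0 {m} (v : 'cV[K]_m) : (norm2 v == 0) = (v == 0).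
Proof.
apply/idP/eqP => [|->]; last first.
  by rewrite /norm2 big1 ?sqrtr0// => i _; rewrite mxE expr0n.
rewrite -sqrf_eq0 norm2_sqr dotE psumr_eq0 => [/allP v0|i _]; last first.
  by rewrite -expr2 sqr_ge0.
apply/colP => i; rewrite mxE; apply/eqP.
by have := v0 i; rewrite mem_index_enum mulf_eq0 orbb; apply.
Qed.

Lemma norm2_0 {m} : norm2 (0 : 'cV[K]_m) = 0.
Proof. by apply/eqP; rewrite norm2_eq0. Qed.

Lemma norm2Z {m} a (v : 'cV[K]_m) : norm2 (a *: v) = `|a| * norm2 v.
Proof.
rewrite /norm2; under eq_bigr do rewrite mxE exprMn.
by rewrite -mulr_sumr sqrtrM ?sqr_ge0// sqrtr_sqr.
Qed.

Lemma dot_combination {m} (a b : K) (u v : 'cV[K]_m) :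
  dot (a *: u + b *: v) (a *: u + b *: v) =
  a ^+ 2 * dot u u + 2 * a * b * dot u v + b ^+ 2 * dot v v.
Proof.
rewrite !dotE !mulr_sumr -!big_split/=; apply: eq_bigr => i _.
by rewrite !mxE; ring.
Qed.

(** Cauchy-Schwarz: the squared norm of (v.v) u - (u.v) v is nonnegative, and it equals v.v times
    the Gram determinant of u and v. *)
Lemma dot_sqr_le {m} (u v : 'cV[K]_m) :
  dot u v ^+ 2 <= norm2 u ^+ 2 * norm2 v ^+ 2.
Proof.
have [->|v0] := eqVneq v 0.
  by rewrite {1}/dot mulmx0 mxE expr0n mulr_ge0 ?sqr_ge0.
have vp : 0 < dot v v.
  by rewrite -norm2_sqr exprn_gt0// lt_neqAle norm2_ge0 eq_sym norm2_eq0 v0.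
have : 0 <= norm2 (dot v v *: u + (- dot u v) *: v) ^+ 2 by exact: sqr_ge0.
rewrite !norm2_sqr dot_combination.
rewrite [X in 0 <= X](_ : _ = dot v v * (dot u u * dot v v - dot u v ^+ 2));
  last by ring.
by rewrite pmulr_rge0// subr_ge0.
Qed.

Lemma dot_le {m} (u v : 'cV[K]_m) : dot u v <= norm2 u * norm2 v.
Proof.
apply: le_trans (ler_norm _) _.
rewrite -ler_sqr ?nnegrE ?mulr_ge0 ?norm2_ge0//.
by rewrite real_normK ?num_real// exprMn dot_sqr_le.
Qed.

Lemma norm2D {m} (u v : 'cV[K]_m) : norm2 (u + v) <= norm2 u + norm2 v.
Proof.
rewrite -ler_sqr ?nnegrE ?addr_ge0 ?norm2_ge0// norm2_sqr.
have := dot_combination 1 1 u v; rewrite !scale1r => ->.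
rewrite sqrrD !norm2_sqr; have := dot_le u v; lra.
Qed.

(** The Frobenius norm dominates A by Cauchy-Schwarz on each row. This bounds the set whose supremum
    is [mxnorm2], so that the supremum is meaningful. *)
Lemma norm2_mulmx_row {m p} (A : 'M[K]_(p, m)) (v : 'cV[K]_m) :
  norm2 (A *m v) <=
  Num.sqrt (\sum_i norm2 (row i A)^T ^+ 2) * norm2 v.
Proof.
have S0 : 0 <= \sum_i norm2 (row i A)^T ^+ 2.
  by apply: sumr_ge0 => i _; exact: sqr_ge0.
rewrite -ler_sqr ?nnegrE ?mulr_ge0 ?norm2_ge0 ?sqrtr_ge0//.
rewrite norm2_sqr exprMn sqr_sqrtr// dotE mulr_suml; apply: ler_sum => i _.
have -> : (A *m v) i 0 = dot (row i A)^T v.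
  by rewrite /dot trmxK -row_mul [in RHS]mxE.
by rewrite -expr2 dot_sqr_le.
Qed.

Lemma mxnorm2_has_ubound {m p} (A : 'M[K]_(p, m)) :
  has_ubound [set norm2 (A *m v) | v in [set v | norm2 v = 1]].
Proof.
exists (Num.sqrt (\sum_i norm2 (row i A)^T ^+ 2)) => _ [v v1 <-].
by apply: le_trans (norm2_mulmx_row _ _) _; rewrite v1 mulr1.
Qed.

Lemma mxnorm2_ge0 {m p} (A : 'M[K]_(p, m)) : 0 <= mxnorm2 A.
Proof.
rewrite /mxnorm2; set S := [set _ | _ in _].
(* For m = 0 there is no unit vector, and the supremum of the empty set is 0. *)
have [->|/set0P[_ [v v1 _]]] := eqVneq S set0; first by rewrite sup0.
apply: le_trans (norm2_ge0 (A *m v)) _.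
by apply: (ub_le_sup (mxnorm2_has_ubound A)); exists v.
Qed.

Lemma norm2_mulmx_le {m p} (A : 'M[K]_(p, m)) (v : 'cV[K]_m) :
  norm2 (A *m v) <= mxnorm2 A * norm2 v.
Proof.
have [->|v0] := eqVneq v 0.
  by rewrite mulmx0 !norm2_0 mulr0.
have vp : 0 < norm2 v by rewrite lt_neqAle norm2_ge0 eq_sym norm2_eq0 v0.
rewrite -ler_pdivrMr//.
have -> : norm2 (A *m v) / norm2 v = norm2 (A *m ((norm2 v)^-1 *: v)).
  by rewrite -scalemxAr norm2Z ger0_norm ?invr_ge0 ?norm2_ge0// mulrC.
apply: (ub_le_sup (mxnorm2_has_ubound A)).
exists ((norm2 v)^-1 *: v) => //=.
by rewrite norm2Z ger0_norm ?invr_ge0 ?norm2_ge0// mulVf// gt_eqF.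
Qed.

Lemma mxnorm2_le {m p} (A : 'M[K]_(p, m)) C : 0 <= C ->
  (forall v, norm2 (A *m v) <= C * norm2 v) -> mxnorm2 A <= C.
Proof.
move=> C0 AC; rewrite /mxnorm2; set S := [set _ | _ in _].
have [->|S0] := eqVneq S set0; first by rewrite sup0.
apply: ge_sup; first exact/set0P.
by move=> _ [v v1 <-]; rewrite (le_trans (AC _))// v1 mulr1.
Qed.

Lemma mxnorm2D {m p} (A B : 'M[K]_(p, m)) :
  mxnorm2 (A + B) <= mxnorm2 A + mxnorm2 B.
Proof.
apply: mxnorm2_le => [|v]; first by rewrite addr_ge0 ?mxnorm2_ge0.
rewrite mulmxDl mulrDl (le_trans (norm2D _ _))//.
by rewrite lerD ?norm2_mulmx_le.
Qed.

Lemma mxnorm2Z {m p} a (A : 'M[K]_(p, m)) :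
  mxnorm2 (a *: A) <= `|a| * mxnorm2 A.
Proof.
apply: mxnorm2_le => [|v]; first by rewrite mulr_ge0 ?mxnorm2_ge0.
by rewrite -scalemxAl norm2Z -mulrA ler_wpM2l ?norm2_mulmx_le.
Qed.

Lemma mxnorm2M {m p q} (A : 'M[K]_(p, m)) (B : 'M[K]_(m, q)) :
  mxnorm2 (A *m B) <= mxnorm2 A * mxnorm2 B.
Proof.
apply: mxnorm2_le => [|v]; first by rewrite mulr_ge0 ?mxnorm2_ge0.
rewrite -mulmxA (le_trans (norm2_mulmx_le _ _))// -mulrA.
by rewrite ler_wpM2l ?mxnorm2_ge0 ?norm2_mulmx_le.
Qed.

(** With y = A^T v, moving A^T across the inner product gives |y|^2 = v.(A y) <= |v| |A| |y|; then
    divide by |y|. *)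
Lemma mxnorm2_tr_le {m p} (A : 'M[K]_(p, m)) : mxnorm2 A^T <= mxnorm2 A.
Proof.
apply: mxnorm2_le => [|v]; first exact: mxnorm2_ge0.
have [->|n0] := eqVneq (norm2 (A^T *m v)) 0.
  by rewrite mulr_ge0 ?mxnorm2_ge0 ?norm2_ge0.
have np : 0 < norm2 (A^T *m v) by rewrite lt_neqAle norm2_ge0 eq_sym n0.
rewrite -(ler_pM2r np) -expr2 norm2_sqr dot_mull trmxK.
apply: le_trans (dot_le _ _) _; rewrite [mxnorm2 A * _]mulrC -mulrA.
by rewrite ler_wpM2l ?norm2_ge0 ?norm2_mulmx_le.
Qed.

Lemma mxnorm2_tr {m p} (A : 'M[K]_(p, m)) : mxnorm2 A^T = mxnorm2 A.
Proof.
apply/eqP; rewrite eq_le mxnorm2_tr_le.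
by rewrite -[X in mxnorm2 X <= _]trmxK mxnorm2_tr_le.
Qed.

Lemma mxnorm2_entry {m p} (A : 'M[K]_(p, m)) i j : `|A i j| <= mxnorm2 A.
Proof.
have e1 : norm2 (delta_mx j 0 : 'cV[K]_m) = 1.
  apply/eqP; rewrite -sqrp_eq1 ?norm2_ge0// norm2_sqr dotE (bigD1 j)//= big1.
    by rewrite mxE !eqxx mulr1 addr0.
  by move=> k /negPf kj; rewrite mxE kj mul0r.
have := norm2_mulmx_le A (delta_mx j 0); rewrite e1 mulr1; apply: le_trans.
rewrite -ler_sqr ?nnegrE ?norm2_ge0// norm2_sqr dotE -colE (bigD1 i)//= mxE.
rewrite -expr2 real_normK ?num_real// lerDl.
by apply: sumr_ge0 => k _; rewrite -expr2 sqr_ge0.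
Qed.

(** Expanding x in the standard basis bounds f x by C times the max norm, C being the sum of the
    values of f on the basis. The triangle inequality then makes f Lipschitz with constant C. *)
Lemma seminorm_continuous {m} (f : 'rV[K]_m -> K) :
  (forall x y, f (x + y) <= f x + f y) ->
  (forall a x, f (a *: x) <= `|a| * f x) ->
  continuous f.
Proof.
move=> fD fZ.
have fge0 x : 0 <= f x.
  have f0 : 0 <= f 0.
    by have := fD 0 0; rewrite addr0; lra.
  have := fD x (- x); rewrite subrr; have := fZ (-1) x.
  rewrite scaleN1r normrN1 mul1r; lra.
have fsum (I : Type) (r : seq I) (F : I -> 'rV[K]_m) :
    f (\sum_(i <- r) F i) <= \sum_(i <- r) f (F i).
  elim: r => [|i r IH]; last by rewrite !big_cons (le_trans (fD _ _))// lerD.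
  by rewrite !big_nil; have := fZ 0 0; rewrite scale0r normr0 mul0r.
pose C := \sum_i f (delta_mx 0 i).
have C0 : 0 <= C by apply: sumr_ge0.
have fC x : f x <= `|x| * C.
  rewrite [x in f x]row_sum_delta (le_trans (fsum _ _ _))//.
  rewrite mulr_sumr; apply: ler_sum => i _; apply: le_trans (fZ _ _) _.
  rewrite ler_wpM2r// [leRHS]/Num.norm /= mx_normrE.
  by apply/bigmax_geP; right => /=; exists (0, i).
have fB x y : `|f x - f y| <= `|x - y| * C.
  have := fD (x - y) y; have := fD (y - x) x; rewrite !subrK.
  have := fC (x - y); have := fC (y - x); rewrite (distrC y x).
  by rewrite ler_norml; lra.
move=> x; have xF : Filter (nbhs x) by exact: nbhs_filter.
apply/(@cvgrPdist_lt _ _ _ (nbhs x)) => e e0.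
(* C may vanish, so the radius is obtained by dividing by C + 1. *)
have C1 : 0 < C + 1 by lra.
apply/(@nbhs_normP K 'rV[K]_m x); exists (e / (C + 1)) => [|y /= xy].
  exact: divr_gt0.
apply: le_lt_trans (fB _ _) _; apply: (@le_lt_trans _ _ (`|x - y| * (C + 1))).
  by rewrite ler_wpM2l// lerDl.
by rewrite -ltr_pdivlMr.
Qed.

Lemma mxnorm2_linear_continuous {m p q} (g : 'rV[K]_m -> 'M[K]_(p, q)) :
  linear g -> continuous (fun x => mxnorm2 (g x)).
Proof.
move=> lin_g; apply: seminorm_continuous => [x y|a x].
  by have := lin_g 1 x y; rewrite !scale1r => ->; exact: mxnorm2D.
have g0 : g 0 = 0.
  have := lin_g 1 0 0; rewrite !scale1r addr0 => /eqP.
  by rewrite -subr_eq subrr => /eqP.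
by have := lin_g a x 0; rewrite !addr0 g0 addr0 => ->; exact: mxnorm2Z.
Qed.

End Euclidean.

(** * Block diagonal matrices and norms of blocks *)

Section Blocks.
Context {K : realType} {n : nat}.

(* Dblock c f is ublock c c^-1 f; with the second diagonal entry as a separate
   parameter the block is linear in (c, e, f). *)
Definition ublock (c e f : K) : 'M[K]_2 :=
  block_mx (c%:M : 'M[K]_1) (f%:M : 'M[K]_1) (0 : 'M[K]_1) (e%:M : 'M[K]_1).

Definition udiag (c e f : 'I_n -> K) : 'M[K]_(twon n) :=
  \mxdiag_(j < n) ublock (c j) (e j) (f j).

Lemma ublock_entries c e f :
  [/\ ublock c e f 0 0 = c, ublock c e f 0 1 = f,
      ublock c e f 1 0 = 0 & ublock c e f 1 1 = e].
Proof.
have -> : (0 : 'I_2) = lshift 1 (0 : 'I_1) by apply: val_inj.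
have -> : (1 : 'I_2) = rshift 1 (0 : 'I_1) by apply: val_inj.
rewrite /ublock (@block_mxEul _ 1 1 1 1) (@block_mxEur _ 1 1 1 1).
rewrite (@block_mxEdl _ 1 1 1 1) (@block_mxEdr _ 1 1 1 1).
by rewrite !mxE eqxx !mulr1n.
Qed.

Lemma ublockM c e f c' e' f' :
  ublock c e f *m ublock c' e' f' =
  ublock (c * c') (e * e') (c * f' + f * e').
Proof.
rewrite /ublock (@mulmx_block _ 1 1 1 1 1 1) !mulmx0 !mul0mx !add0r !addr0.
by rewrite -!scalar_mxM raddfD.
Qed.

Lemma ublockD c e f c' e' f' :
  ublock c e f + ublock c' e' f' = ublock (c + c') (e + e') (f + f').
Proof. by rewrite /ublock (@add_block_mx _ 1 1 1 1) addr0 !raddfD. Qed.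

Lemma ublock_scalar a : ublock a a 0 = a%:M.
Proof. by rewrite /ublock raddf0 -(@scalar_mx_block _ 1 1). Qed.

Lemma mul_mxdiag (A B : 'I_n -> 'M[K]_2) :
  (\mxdiag_j A j) *m (\mxdiag_j B j) = \mxdiag_j (A j *m B j).
Proof.
rewrite {2}/mxdiag mul_mxdiag_mxblock; apply/eq_mxblock => i j.
by case: eqVneq => [->|_]; rewrite ?conform_mx_id ?mulmx0.
Qed.

Lemma udiagM c e f c' e' f' :
  udiag c e f *m udiag c' e' f' =
  udiag (fun j => c j * c' j) (fun j => e j * e' j)
        (fun j => c j * f' j + f j * e' j).
Proof. by rewrite mul_mxdiag; apply/eq_mxdiag => j; rewrite ublockM. Qed.

Lemma udiag_scalar a : udiag (fun=> a) (fun=> a) (fun=> 0) = a%:M.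
Proof. by rewrite -mxdiagZ; apply/eq_mxdiag => j; rewrite ublock_scalar. Qed.

Lemma udiagD c e f c' e' f' :
  udiag (fun j => c j + c' j) (fun j => e j + e' j) (fun j => f j + f' j) =
  udiag c e f + udiag c' e' f'.
Proof. by rewrite -mxdiagD; apply/eq_mxdiag => j; rewrite ublockD. Qed.

Lemma udiagZ a c e f :
  udiag (fun j => a * c j) (fun j => a * e j) (fun j => a * f j) =
  a *: udiag c e f.
Proof.
rewrite -mul_scalar_mx -udiag_scalar udiagM.
by apply/eq_mxdiag => j; rewrite mul0r addr0.
Qed.

(** A triangular 2 x 2 block of determinant 1 is inverted by exchanging its diagonal entries and
    negating the upper one, so the inverse is linear in (c, e, f) too. *)
Lemma udiag_inv c e f : (forall j, c j * e j = 1) ->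
  udiag c e f *m udiag e c (fun j => - f j) = 1%:M.
Proof.
move=> ce; rewrite udiagM -udiag_scalar; apply/eq_mxdiag => j.
by rewrite [e j * _]mulrC ce; congr ublock; ring.
Qed.

Lemma mulmx1_invmx {m} (A B : 'M[K]_m) : A *m B = 1%:M -> invmx A = B.
Proof.
by move=> AB; rewrite -[LHS]mulmx1 -AB mulKmx//; case: (mulmx1_unit AB).
Qed.

Lemma invmxM {m} (A B : 'M[K]_m) : A \in unitmx -> B \in unitmx ->
  invmx (A *m B) = invmx B *m invmx A.
Proof.
move=> Au Bu; apply: mulmx1_invmx.
by rewrite -mulmxA [B *m _]mulmxA mulmxV// mul1mx mulmxV.
Qed.

Lemma dot_submxcol (u v : 'cV[K]_(twon n)) :
  dot u v = \sum_j dot (@submxcol K n (fun=> 2%N) 1 u j)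
                       (@submxcol K n (fun=> 2%N) 1 v j).
Proof.
rewrite /dot -{1}[u](@submxcolK _ _ (fun=> 2%N)) tr_mxcol.
rewrite -{1}[v](@submxcolK _ _ (fun=> 2%N)) mul_mxrow_mxcol.
by rewrite summxE.
Qed.

Lemma mxnorm2_submxcol_le {q} (A : 'M[K]_(twon n, q)) j :
  mxnorm2 (@submxcol K n (fun=> 2%N) q A j) <= mxnorm2 A.
Proof.
apply: mxnorm2_le => [|v]; first exact: mxnorm2_ge0.
apply: le_trans (norm2_mulmx_le _ _); rewrite submxcol_mul norm2_le.
rewrite (dot_submxcol (A *m v)) [X in _ <= X](bigD1 j)//= lerDl.
by apply: sumr_ge0 => i _; rewrite -norm2_sqr sqr_ge0.
Qed.

(** Transposition reduces the restriction to a block column to that to a block row. *)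
Lemma mxnorm2_submxblock_le (A : 'M[K]_(twon n)) i j :
  mxnorm2 (@submxblock K n n (fun=> 2%N) (fun=> 2%N) A i j) <= mxnorm2 A.
Proof.
rewrite submxblockEv -mxnorm2_tr tr_submxrow.
apply: le_trans (mxnorm2_submxcol_le _ _) _.
by rewrite mxnorm2_tr mxnorm2_submxcol_le.
Qed.

Lemma mxnorm2_mxdiag_le (A : 'I_n -> 'M[K]_2) t : 0 <= t ->
  (forall j, mxnorm2 (A j) <= t) -> mxnorm2 (\mxdiag_j A j) <= t.
Proof.
move=> t0 At; apply: mxnorm2_le => // v.
rewrite -ler_sqr ?nnegrE ?mulr_ge0 ?norm2_ge0// exprMn !norm2_sqr.
rewrite !dot_submxcol mulr_sumr; apply: ler_sum => j _.
have -> : submxcol (\mxdiag_j A j *m v) j = A j *m submxcol v j.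
  by rewrite -{1}[v](@submxcolK _ _ (fun=> 2%N)) mul_mxdiag_mxcol mxcolK.
rewrite -!norm2_sqr -exprMn ler_sqr ?nnegrE ?mulr_ge0 ?norm2_ge0//.
by rewrite (le_trans (norm2_mulmx_le _ _))// ler_wpM2r ?norm2_ge0.
Qed.

(** The squared norm of A v is the sum of those of its blocks, so bounds on the squared norms of the
    block rows add up. *)
Lemma mxnorm2_sqr_sum_le {q} (A : 'M[K]_(twon n, q)) (t : 'I_n -> K) :
  (forall j, mxnorm2 (@submxcol K n (fun=> 2%N) q A j) ^+ 2 <= t j) ->
  mxnorm2 A <= Num.sqrt (\sum_j t j).
Proof.
move=> At; have t0 j : 0 <= t j by apply: le_trans (At j); exact: sqr_ge0.
apply: mxnorm2_le => [|v]; first exact: sqrtr_ge0.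
rewrite -ler_sqr ?nnegrE ?mulr_ge0 ?norm2_ge0 ?sqrtr_ge0//.
rewrite norm2_sqr exprMn sqr_sqrtr ?sumr_ge0// dot_submxcol mulr_suml.
apply: ler_sum => j _; rewrite -norm2_sqr -submxcol_mul.
apply: (@le_trans _ _ ((mxnorm2 (submxcol A j) * norm2 v) ^+ 2)).
  by rewrite ler_sqr ?nnegrE ?mulr_ge0 ?norm2_ge0 ?mxnorm2_ge0 ?norm2_mulmx_le.
by rewrite exprMn ler_wpM2r ?sqr_ge0.
Qed.

Lemma submxcol_udiag_mul c e f {q} (A : 'M[K]_(twon n, q)) j :
  @submxcol K n (fun=> 2%N) q (udiag c e f *m A) j =
  ublock (c j) (e j) (f j) *m submxcol A j.
Proof.
by rewrite -{1}[A](@submxcolK _ _ (fun=> 2%N)) mul_mxdiag_mxcol mxcolK.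
Qed.

Lemma udiag_entry_le c e f j :
  [/\ `|c j| <= mxnorm2 (udiag c e f), `|e j| <= mxnorm2 (udiag c e f) &
      `|f j| <= mxnorm2 (udiag c e f)].
Proof.
have := mxnorm2_submxblock_le (udiag c e f) j j.
rewrite submxblock_diag => /(le_trans (mxnorm2_entry _ _ _)) le.
have [E00 E01 _ E11] := ublock_entries (c j) (e j) (f j).
by have := (le 0 0, le 0 1, le 1 1); rewrite E00 E01 E11 => -[[]].
Qed.

End Blocks.

(** * Gram matrices of two-column blocks *)

Section GramBlock.
Context {K : realType} {N : nat}.
Implicit Types (A : 'M[K]_(N, 2)) (u w : 'cV[K]_2).

Lemma dot2 u w : dot u w = u 0 0 * w 0 0 + u 1 0 * w 1 0.
Proof.
rewrite dotE !big_ord_recl big_ord0 addr0.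
by congr (_ + u _ _ * w _ _); apply: val_inj.
Qed.

Lemma mulmx_col2 {p} (A : 'M[K]_(p, 2)) u :
  A *m u = u 0 0 *: col 0 A + u 1 0 *: col 1 A.
Proof.
apply/colP => i; rewrite !mxE !big_ord_recl big_ord0 addr0.
rewrite mulrC [X in _ + X]mulrC; congr (_ + u _ _ * A _ _); exact: val_inj.
Qed.

Lemma det2 (G : 'M[K]_2) : \det G = G 0 0 * G 1 1 - G 0 1 * G 1 0.
Proof.
rewrite (expand_det_row _ 0) !big_ord_recl big_ord0 /cofactor !det_mx11 !mxE.
rewrite /= addr0 expr0 expr1 mul1r mulN1r mulrN.
by congr (G _ _ * G _ _ - G _ _ * G _ _); apply: val_inj.
Qed.

Lemma det_gram A :
  \det (A^T *m A) =
  dot (col 0 A) (col 0 A) * dot (col 1 A) (col 1 A)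
  - dot (col 0 A) (col 1 A) ^+ 2.
Proof.
have gramE i j : (A^T *m A) i j = dot (col i A) (col j A).
  by rewrite mxE dotE; apply: eq_bigr => k _; rewrite !mxE.
by rewrite det2 !gramE (dotC (col 1 A) (col 0 A)) expr2.
Qed.

(** A left inverse makes the columns of A independent, which excludes a zero second column and
    equality in Cauchy-Schwarz. *)
Lemma det_gram_gt0 A (X : 'M[K]_(2, N)) :
  X *m A = 1%:M -> 0 < \det (A^T *m A) /\ 0 < norm2 (col 1 A).
Proof.
move=> XA.
have inj u : A *m u = 0 -> u = 0.
  by move=> Au; rewrite -[u]mul1mx -XA -mulmxA Au mulmx0.
have L2 : 0 < norm2 (col 1 A).
  rewrite lt_neqAle norm2_ge0 andbT eq_sym norm2_eq0; apply/eqP => A1.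
  have /matrixP/(_ 1 0)/eqP : (delta_mx 1 0 : 'cV[K]_2) = 0.
    by apply: inj; rewrite -colE.
  by rewrite !mxE !eqxx oner_eq0.
split=> //; rewrite det_gram lt_neqAle subr_ge0 -!norm2_sqr dot_sqr_le andbT.
(* This is the first column of the adjugate of the Gram matrix. The squared norm of A u is the Gram
   determinant times the squared norm of the second column, hence 0, although u has a nonzero first
   entry. *)
apply/eqP => det0; pose u : 'cV[K]_2 :=
  \col_i if i == 0 then norm2 (col 1 A) ^+ 2 else - dot (col 0 A) (col 1 A).
have /colP/(_ 0)/eqP : u = 0.
  apply: inj; apply/eqP; rewrite -norm2_eq0 -sqrf_eq0 norm2_sqr mulmx_col2.
  rewrite dot_combination !mxE/= -!norm2_sqr; apply/eqP.
  rewrite [LHS](_ : _ = norm2 (col 1 A) ^+ 2 * (norm2 (col 0 A) ^+ 2 *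
    norm2 (col 1 A) ^+ 2 - dot (col 0 A) (col 1 A) ^+ 2)); last by ring.
  by rewrite -det0 mulr0.
by rewrite !mxE eqxx sqrf_eq0 gt_eqF.
Qed.

(* The scaling turns the Gram matrix of the block into
   [[beta^2, sigma], [sigma, beta^2]]. *)
Lemma norm2_scaled_block A (b s : K) w :
  0 < b -> 0 < norm2 (col 1 A) -> s ^+ 2 = b ^+ 4 - \det (A^T *m A) ->
  let r := norm2 (col 1 A) in
  norm2 ((ublock (r / b) (r / b)^-1
            ((- dot (col 0 A) (col 1 A) + s) / (b * r)) *m A^T)^T *m w) ^+ 2 =
  b ^+ 2 * norm2 w ^+ 2 + 2 * s * (w 0 0 * w 1 0).
Proof.
move=> b0 L2 sE r; rewrite trmx_mul trmxK -mulmxA.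
set f := (_ + s) / _; set P := ublock _ _ _.
have [P00 P01 P10 P11] := ublock_entries (r / b) (r / b)^-1 f.
rewrite mulmx_col2 norm2_sqr dot_combination norm2_sqr dot2.
have tr2 i : (P^T *m w) i 0 = P 0 i * w 0 0 + P 1 i * w 1 0.
  by rewrite mulmx_col2 !mxE mulrC [X in _ + X]mulrC.
rewrite !tr2 P00 P01 P10 P11 /f -(norm2_sqr (col 1 A)) -/r.
(* The determinant equation is solved for the squared norm of the first column, which leaves an
   identity of rational functions. *)
have -> : dot (col 0 A) (col 0 A) =
    (b ^+ 4 - s ^+ 2 + dot (col 0 A) (col 1 A) ^+ 2) / r ^+ 2.
  by rewrite sE det_gram -[dot (col 1 A) _]norm2_sqr -/r; field; rewrite gt_eqF.
by field; rewrite !gt_eqF.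
Qed.

Lemma norm2_scaled_block_bounds A (b s t : K) w :
  0 < b -> 0 < norm2 (col 1 A) -> s ^+ 2 = b ^+ 4 - \det (A^T *m A) ->
  `|s| <= t ->
  let r := norm2 (col 1 A) in
  let S := (ublock (r / b) (r / b)^-1
            ((- dot (col 0 A) (col 1 A) + s) / (b * r)) *m A^T)^T in
  (b ^+ 2 - t) * norm2 w ^+ 2 <= norm2 (S *m w) ^+ 2 <=
  (b ^+ 2 + t) * norm2 w ^+ 2.
Proof.
move=> b0 L2 sE st; cbv zeta; rewrite norm2_scaled_block// norm2_sqr dot2.
have : `|2 * s * (w 0 0 * w 1 0)| <= t * (w 0 0 * w 0 0 + w 1 0 * w 1 0).
  rewrite [2 * s]mulrC -mulrA normrM ler_pM// ler_norml.
  (* These two squares give 2 |w_0 w_1| <= |w|^2, which controls the off-diagonal term. *)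
  have := sqr_ge0 (w 0 0 + w 1 0); have := sqr_ge0 (w 0 0 - w 1 0).
  by nra.
by rewrite ler_norml => /andP[lo hi]; apply/andP; split; lra.
Qed.

End GramBlock.

(** * Norm estimates for the scaled matrix [Dtilde R s *m R] *)

Section Scaling.
Context {K : realType} {n : nat} (R : 'M[K]_(twon n)).
Hypotheses (n_gt0 : (0 < n)%N) (R_unit : R \in unitmx).
Implicit Types (s : 'I_n -> bool) (D : 'M[K]_(twon n)).

(** This product is the j-th diagonal block of R R^-1. After transposition it supplies the left
    inverse of [Lblock R j] required by [det_gram_gt0]. *)
Lemma submxcol_right_inverse j :
  @submxcol K n (fun=> 2%N) _ R j *m
  @submxrow K n (fun=> 2%N) _ (invmx R) j = 1%:M.
Proof.
rewrite mul_submxrow submxcol_mul mulmxV// -submxblockEv -mxdiagZ.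
by rewrite submxblock_diag.
Qed.

Lemma Lblock_gram_gt0 j :
  0 < \det ((Lblock R j)^T *m Lblock R j) /\ 0 < norm2 (L2 R j).
Proof.
apply: (det_gram_gt0 _ (@submxrow K n (fun=> 2%N) _ (invmx R) j)^T).
by rewrite /Lblock -trmx_mul submxcol_right_inverse trmx1.
Qed.

Lemma beta_j_gt0 j : 0 < beta_ R j.
Proof. by rewrite /beta_ powR_gt0//; case: (Lblock_gram_gt0 j). Qed.

Lemma beta_pow4 j : beta_ R j ^+ 4 = \det ((Lblock R j)^T *m Lblock R j).
Proof.
have [/ltW det0 _] := Lblock_gram_gt0 j.
by rewrite -powR_mulrn ?powR_ge0// -powRrM mulVf ?powRr1// pnatr_eq0.
Qed.

Lemma beta_le_beta j : beta_ R j <= beta R.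
Proof. exact: le_bigmax. Qed.

Lemma beta_gt0 : 0 < beta R.
Proof. exact: lt_le_trans (beta_j_gt0 _) (beta_le_beta (Ordinal n_gt0)). Qed.

Lemma gamma_le_beta_j j : gamma R <= beta_ R j.
Proof. exact: bigmin_le. Qed.

Lemma gamma_gt0 : 0 < gamma R.
Proof.
(* The minimum starts from the initial value [beta R], whose positivity must be checked as well. *)
by apply/bigmin_gtP; split=> [|j _]; [exact: beta_gt0 | exact: beta_j_gt0].
Qed.

Lemma calD_udiag D : calD D -> exists c e f : 'I_n -> K,
  (forall j, c j * e j = 1) /\ D = udiag c e f.
Proof.
move=> [c [f [c0 ->]]]; exists c, (fun j => (c j)^-1), f; split=> // j.
by rewrite divff.
Qed.

Lemma udiag_calD c e f : (forall j, c j * e j = 1) -> @calD K n (udiag c e f).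
Proof.
move=> ce; have c0 j : c j != 0.
  by apply/eqP => c0; have /eqP := ce j; rewrite c0 mul0r eq_sym oner_eq0.
exists c, f; split=> //; apply/eq_mxdiag => j; congr (ublock _ _ _).
by apply: (mulfI (c0 j)); rewrite ce divff.
Qed.

Lemma udiag_unit c e f : (forall j, c j * e j = 1) ->
  udiag c e f \in @unitmx K (twon n).
Proof. by move=> ce; case: (mulmx1_unit (udiag_inv _ _ f ce)). Qed.

Lemma calD_unit D : calD D -> D \in unitmx.
Proof. by move=> /calD_udiag[c [e [f [ce ->]]]]; exact: udiag_unit. Qed.

Let bet := beta R.
Let tau := Num.sqrt (bet ^+ 4 - gamma R ^+ 4).

(** After squaring, this is beta^4 - gamma^4 < beta^4. The radicand is nonnegative because some
    index exists and gamma <= beta_j <= beta there. *)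
Lemma beta_sqr_gt_tau : tau < bet ^+ 2.
Proof.
rewrite -ltr_sqr ?nnegrE ?sqrtr_ge0 ?sqr_ge0// -exprM sqr_sqrtr.
  by rewrite ltrBlDr ltrDl exprn_gt0 ?gamma_gt0.
rewrite subr_ge0 lerXn2r ?nnegrE ?(ltW gamma_gt0) ?(ltW beta_gt0)//.
exact: le_trans (gamma_le_beta_j (Ordinal n_gt0)) (beta_le_beta _).
Qed.

Lemma DtildeE s :
  Dtilde R s = udiag (ctilde R) (fun j => (ctilde R j)^-1) (ftilde R s).
Proof. by []. Qed.

Lemma ctilde_neq0 j : ctilde R j != 0.
Proof.
rewrite mulf_neq0 ?invr_eq0 ?(gt_eqF beta_gt0)//.
by have [_ /lt0r_neq0] := Lblock_gram_gt0 j.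
Qed.

Lemma Dtilde_calD s : calD (Dtilde R s).
Proof.
by exists (ctilde R), (ftilde R s); split=> // j; exact: ctilde_neq0.
Qed.

(** The off-diagonal Gram entry is a signed square root of beta^4 - beta_j^4, of modulus at most tau
    since gamma <= beta_j; the choice of sign does not affect the modulus. *)
Lemma Dtilde_block_bounds s j w :
  (bet ^+ 2 - tau) * norm2 w ^+ 2 <=
  norm2 ((@submxcol K n (fun=> 2%N) _ (Dtilde R s *m R) j)^T *m w) ^+ 2 <=
  (bet ^+ 2 + tau) * norm2 w ^+ 2.
Proof.
have [_ L20] := Lblock_gram_gt0 j.
have bj4 : 0 <= bet ^+ 4 - beta_ R j ^+ 4.
  rewrite subr_ge0 lerXn2r ?nnegrE ?(ltW beta_gt0) ?(ltW (beta_j_gt0 _))//.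
  exact: beta_le_beta.
rewrite DtildeE submxcol_udiag_mul -[submxcol R j]trmxK.
apply: norm2_scaled_block_bounds => //; first exact: beta_gt0.
  by rewrite exprMn sqr_sqrtr// sqrr_sign mul1r beta_pow4.
rewrite normrM normr_sign mul1r ger0_norm ?sqrtr_ge0// ler_wsqrtr//.
rewrite lerB// lerXn2r ?nnegrE ?(ltW gamma_gt0) ?(ltW (beta_j_gt0 _))//.
exact: gamma_le_beta_j.
Qed.

(** Each of the n block rows contributes at most beta^2 + tau <= 2 beta^2 to the squared norm. *)
Lemma mxnorm2_Dtilde_le s :
  mxnorm2 (Dtilde R s *m R) <= Num.sqrt (2 * n)%:R * bet.
Proof.
have -> : Num.sqrt (2 * n)%:R * bet = Num.sqrt (\sum_(j < n) 2 * bet ^+ 2).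
  rewrite sumr_const card_ord -[X in _ = Num.sqrt X]mulr_natr mulrAC.
  rewrite -natrM sqrtrM ?ler0n//.
  by rewrite sqrtr_sqr ger0_norm// ltW// beta_gt0.
have bb : 0 <= 2 * bet ^+ 2 by rewrite pmulr_rge0 ?sqr_ge0.
apply: mxnorm2_sqr_sum_le => j; rewrite -mxnorm2_tr -[leRHS]sqr_sqrtr//.
rewrite ler_sqr ?nnegrE ?mxnorm2_ge0 ?sqrtr_ge0//.
apply: mxnorm2_le => [|w]; first exact: sqrtr_ge0.
rewrite -ler_sqr ?nnegrE ?mulr_ge0 ?norm2_ge0 ?sqrtr_ge0//.
rewrite exprMn (sqr_sqrtr bb).
have /andP[_ hi] := Dtilde_block_bounds s j w; apply: le_trans hi _.
by rewrite ler_wpM2r ?sqr_ge0//; have := beta_sqr_gt_tau; lra.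
Qed.

Lemma mxnorm2_transition_le s D : calD D ->
  mxnorm2 (D *m invmx (Dtilde R s)) <=
  mxnorm2 (D *m R) * (Num.sqrt (bet ^+ 2 + tau) / gamma R ^+ 2).
Proof.
have tau0 : 0 <= tau by exact: sqrtr_ge0.
have tauE : tau ^+ 2 = bet ^+ 4 - gamma R ^+ 4.
  rewrite sqr_sqrtr// subr_ge0.
  rewrite lerXn2r ?nnegrE ?(ltW gamma_gt0) ?(ltW beta_gt0)//.
  exact: le_trans (gamma_le_beta_j (Ordinal n_gt0)) (beta_le_beta _).
have btau := beta_sqr_gt_tau; have g0 := gamma_gt0.
have bp : 0 <= bet ^+ 2 + tau by rewrite addr_ge0 ?sqr_ge0.
move=> /calD_udiag[c [e [f [ce DE]]]].
set t := (_ / _); have t0 : 0 <= t by rewrite divr_ge0 ?sqrtr_ge0 ?sqr_ge0.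
(* Since (beta^2 + tau)(beta^2 - tau) = gamma^4, the factor t is the inverse square root of the
   lower eigenvalue bound. *)
have tE : t ^+ 2 * (bet ^+ 2 - tau) = 1.
  have gn : gamma R != 0 by rewrite gt_eqF.
  rewrite exprMn sqr_sqrtr//.
  rewrite [LHS](_ : _ = (bet ^+ 4 - tau ^+ 2) / gamma R ^+ 4); last by field.
  by rewrite tauE subKr divff// expf_neq0.
clearbody t; have ctE j : ctilde R j * (ctilde R j)^-1 = 1.
  by rewrite divff// ctilde_neq0.
rewrite {1}DtildeE (mulmx1_invmx _ _ (udiag_inv _ _ _ ctE)) DE udiagM.
apply: mxnorm2_mxdiag_le => [|j]; first by rewrite mulr_ge0 ?mxnorm2_ge0.
rewrite -mxnorm2_tr; apply: mxnorm2_le => [|w].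
  by rewrite mulr_ge0 ?mxnorm2_ge0.
rewrite -ler_sqr ?nnegrE ?mulr_ge0 ?norm2_ge0 ?mxnorm2_ge0//.
set E := ublock _ _ _.
(* E is the j-th diagonal block of D Dtilde^-1, so it carries the block row of Dtilde R to that of D
   R. *)
have EM : E *m submxcol (Dtilde R s *m R) j = submxcol (D *m R) j.
  rewrite DE DtildeE !submxcol_udiag_mul mulmxA ublockM.
  congr (ublock _ _ _ *m _).
  - by rewrite -mulrA [_^-1 * _]mulrC ctE mulr1.
  - by rewrite -mulrA ctE mulr1.
  - have := ctE j; set x := ctilde R j; set y := x^-1.
    by clearbody y => xy; ring: xy.
(* Inserting 1 = t^2 (beta^2 - tau) lets the lower block bound apply to the vector E^T w. *)
rewrite !exprMn -[leLHS]mulr1 -tE mulrCA.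
have /andP[le _] := Dtilde_block_bounds s j (E^T *m w).
rewrite [leRHS](_ : _ = t ^+ 2 * (mxnorm2 (D *m R) * norm2 w) ^+ 2);
  last by rewrite DE; ring.
rewrite ler_wpM2l ?sqr_ge0// mulrC; apply: le_trans le _.
rewrite mulmxA -trmx_mul EM ler_sqr ?nnegrE ?mulr_ge0 ?norm2_ge0 ?mxnorm2_ge0//.
apply: le_trans (norm2_mulmx_le _ _) _.
by rewrite ler_wpM2r ?norm2_ge0// mxnorm2_tr mxnorm2_submxcol_le.
Qed.

Lemma kappa2_Dtilde_le s D : calD D ->
  kappa2 (Dtilde R s *m R) <=
  Num.sqrt (2 * n)%:R
    * (bet * Num.sqrt (bet ^+ 2 + tau) / gamma R ^+ 2) * kappa2 (D *m R).
Proof.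
move=> DD; have Du := calD_unit _ DD.
have tu : Dtilde R s \in unitmx.
  exact/calD_unit/Dtilde_calD.
have -> : kappa2 (Dtilde R s *m R) = mxnorm2 (Dtilde R s *m R) *
    mxnorm2 (invmx (D *m R) *m (D *m invmx (Dtilde R s))).
  by rewrite /kappa2 !invmxM// -mulmxA [invmx D *m _]mulmxA mulVmx// mul1mx.
set C := Num.sqrt (bet ^+ 2 + tau) / gamma R ^+ 2.
apply: (@le_trans _ _ ((Num.sqrt (2 * n)%:R * bet) *
    (mxnorm2 (invmx (D *m R)) * (mxnorm2 (D *m R) * C)))).
  apply: ler_pM; [exact: mxnorm2_ge0..|exact: mxnorm2_Dtilde_le|].
  apply: le_trans (mxnorm2M _ _) _.
  by rewrite ler_wpM2l ?mxnorm2_ge0 ?mxnorm2_transition_le.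
rewrite [bet * _ / _](_ : _ = bet * C); last by rewrite mulrA.
rewrite /kappa2 le_eqVlt; apply/orP; left; apply/eqP; ring.
Qed.

End Scaling.

(** * Existence of the minimum by compactness *)

Section Minimum.
Context {K : realType} {n : nat} (R : 'M[K]_(twon n)).
Hypothesis R_unit : R \in unitmx.
Implicit Types (c e f : 'I_n -> K).

Lemma kappa2_udiag c e f : (forall j, c j * e j = 1) ->
  kappa2 (udiag c e f *m R) =
  mxnorm2 (udiag c e f *m R)
    * mxnorm2 (invmx R *m udiag e c (fun j => - f j)).
Proof.
move=> ce; rewrite /kappa2 invmxM ?udiag_unit//.
by rewrite (mulmx1_invmx _ _ (udiag_inv _ _ f ce)).
Qed.

(** Multiply |D| <= |D R| |R^-1| by 1 <= |D^-1| <= |R| |R^-1 D^-1|: the right-hand sides regroup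
    into kappa2 (D R) kappa2 R. *)
Lemma udiag_entries_bound c e f j : (forall j, c j * e j = 1) ->
  kappa2 (udiag c e f *m R) <= kappa2 R ->
  [/\ `|c j| <= kappa2 R ^+ 2, `|e j| <= kappa2 R ^+ 2 &
      `|f j| <= kappa2 R ^+ 2].
Proof.
move=> ce le; suff DN : mxnorm2 (udiag c e f) <= kappa2 R ^+ 2.
  by have [] := udiag_entry_le c e f j; split; apply: le_trans DN.
have k0 : 0 <= kappa2 R by rewrite mulr_ge0 ?mxnorm2_ge0.
apply: (@le_trans _ _ (kappa2 (udiag c e f *m R) * kappa2 R)); last first.
  by rewrite expr2 ler_wpM2r.
set Di := udiag e c (fun j => - f j).
(* Both c_j and e_j are entries of D^-1 up to position, and their product is 1. *)
have Di1 : 1 <= mxnorm2 Di.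
  have [le_e le_c _] := udiag_entry_le e c (fun j => - f j) j.
  rewrite -ler_sqr ?nnegrE ?mxnorm2_ge0// expr1n expr2.
  by rewrite -(normr1 K) -(ce j) normrM mulrC ler_pM.
have le1 : mxnorm2 (udiag c e f) <=
    mxnorm2 (udiag c e f *m R) * mxnorm2 (invmx R).
  by rewrite -{1}[udiag c e f](mulmxK R_unit) mxnorm2M.
have le2 : 1 <= mxnorm2 R * mxnorm2 (invmx R *m Di).
  by apply: le_trans Di1 _; rewrite -{1}[Di](mulKVmx R_unit) mxnorm2M.
apply: le_trans le1 _; rewrite kappa2_udiag// -/Di /kappa2.
rewrite [leRHS](_ : _ = (mxnorm2 (udiag c e f *m R) * mxnorm2 (invmx R)) *
  (mxnorm2 R * mxnorm2 (invmx R *m Di))); last by ring.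
by rewrite ler_peMr// mulr_ge0 ?mxnorm2_ge0.
Qed.

(** The extreme value theorem [EVT_min_rV] concerns row vectors, so the triple (c, e, f) is
    flattened into a row of length 3n. *)
Definition diag_part (x : 'rV[K]_(n + (n + n))) j := x 0 (lshift (n + n) j).
Definition inv_part (x : 'rV[K]_(n + (n + n))) j := x 0 (rshift n (lshift n j)).
Definition upper_part (x : 'rV[K]_(n + (n + n))) j :=
  x 0 (rshift n (rshift n j)).

Definition to_row c e f : 'rV[K]_(n + (n + n)) :=
  row_mx (\row_j c j) (row_mx (\row_j e j) (\row_j f j)).

Lemma to_rowK c e f :
  [/\ diag_part (to_row c e f) = c, inv_part (to_row c e f) = e &
      upper_part (to_row c e f) = f].
Proof.
by split; apply/funext => j; rewrite /diag_part /inv_part /upper_part /to_row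
  ?row_mxEr ?row_mxEl mxE.
Qed.

(* The entries c_jj^-1 are carried along as extra coordinates, so that this
   function is a product of two seminorms, continuous on the whole space. *)
Definition kappa_row x :=
  mxnorm2 (udiag (diag_part x) (inv_part x) (upper_part x) *m R) *
  mxnorm2 (invmx R *m
    udiag (inv_part x) (diag_part x) (fun j => - upper_part x j)).

Lemma kappa_row_continuous : continuous kappa_row.
Proof.
(* The coordinate maps are kept general because the second factor exchanges c with e and negates
   f. *)
have lin_udiag (c e f : 'rV[K]_(n + (n + n)) -> 'I_n -> K) a x y :
    (forall j, c (a *: x + y) j = a * c x j + c y j) ->
    (forall j, e (a *: x + y) j = a * e x j + e y j) ->
    (forall j, f (a *: x + y) j = a * f x j + f y j) ->
    udiag (c (a *: x + y)) (e (a *: x + y)) (f (a *: x + y)) =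
    a *: udiag (c x) (e x) (f x) + udiag (c y) (e y) (f y).
  move=> cl el fl; rewrite -udiagZ -udiagD.
  by apply/eq_mxdiag => j; rewrite cl el fl.
have cont1 : continuous (fun x =>
    mxnorm2 (udiag (diag_part x) (inv_part x) (upper_part x) *m R)).
  apply: mxnorm2_linear_continuous => a x y; rewrite scalemxAl -mulmxDl.
  by congr (_ *m _); apply: lin_udiag => j;
    rewrite /diag_part /inv_part /upper_part !mxE.
have cont2 : continuous (fun x => mxnorm2
    (invmx R *m udiag (inv_part x) (diag_part x) (fun j => - upper_part x j))).
  apply: mxnorm2_linear_continuous => a x y; rewrite scalemxAr -mulmxDr.
  congr (_ *m _).
  apply: (lin_udiag inv_part diag_part (fun x j => - upper_part x j)) => j;
    rewrite /diag_part /inv_part /upper_part !mxE//; ring.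
move=> x; apply: (@cvgM K _ (nbhs x) (nbhs_filter x)).
  exact: cont1.
exact: cont2.
Qed.

(** The closed conditions c_j e_j = 1 cut a compact set out of a box, on which the continuous
    [kappa_row] attains its minimum. The box holds every matrix of the class whose condition number
    after scaling is at most kappa2 R. *)
Lemma exists_min_kappa2 : exists2 D, calD D &
  forall D', calD D' -> kappa2 (D *m R) <= kappa2 (D' *m R).
Proof.
pose B := kappa2 R ^+ 2.
pose box : set 'rV[K]_(n + (n + n)) :=
  [set x | forall i, x ord0 i \in `[- B, B]].
pose A := box `&` \bigcap_(j in [set: 'I_n])
  ((fun x => diag_part x j * inv_part x j) @^-1` [set 1]).
have AP c e f : (forall j, c j * e j = 1) ->
    kappa2 (udiag c e f *m R) <= kappa2 R -> A (to_row c e f).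
  move=> ce le; have [Ec Ee Ef] := to_rowK c e f.
  split=> [i|j _] /=; last first.
    by rewrite Ec Ee ce.
  rewrite in_itv/= -ler_norml.
  case: (split_ordP i) => [j ->|k ->].
    have [+ _ _] := udiag_entries_bound c e f j ce le.
    by rewrite -[in X in `|X| <= _]Ec.
  case: (split_ordP k) => [j ->|j ->].
    have [_ + _] := udiag_entries_bound c e f j ce le.
    by rewrite -[in X in `|X| <= _]Ee.
  have [_ _] := udiag_entries_bound c e f j ce le.
  by rewrite -[in X in `|X| <= _]Ef.
have one1 (j : 'I_n) : 1 * 1 = 1 :> K by rewrite mulr1.
have A0 : A !=set0.
  exists (to_row (fun=> 1) (fun=> 1) (fun=> 0)); apply: AP => //.
  by rewrite udiag_scalar mul1mx.
have cA : compact A.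
  apply: compact_closedI; first exact:
    rV_compact (fun=> `[- B, B]%classic) (fun=> @segment_compact _ _ _).
  apply: closed_bigI => j _; apply: preimage_closed; last exact: closed_eq.
  move=> x _; apply: (@cvgM K _ (nbhs x) (nbhs_filter x));
    exact: coord_continuous.
have [x xA xmin] :=
  EVT_min_rV A0 cA (continuous_subspaceT kappa_row_continuous).
have xce j : diag_part x j * inv_part x j = 1.
  by move: xA; rewrite inE => -[_ /(_ j I)].
exists (udiag (diag_part x) (inv_part x) (upper_part x)).
  exact: udiag_calD.
move=> _ /calD_udiag[c [e [f [ce ->]]]].
rewrite (kappa2_udiag _ _ _ xce) -/(kappa_row x).
have kE c' e' f' : (forall j, c' j * e' j = 1) ->
    kappa2 (udiag c' e' f' *m R) = kappa_row (to_row c' e' f').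
  move=> ce'; have [Ec Ee Ef] := to_rowK c' e' f'.
  by rewrite (kappa2_udiag _ _ _ ce') /kappa_row Ec Ee Ef.
(* A competitor with value above kappa2 R may lie outside the box; the minimum still lies below it,
   because the identity belongs to the compact set with value kappa2 R. *)
have [le|/ltW gt] := leP (kappa2 (udiag c e f *m R)) (kappa2 R).
  by rewrite (kE _ _ _ ce); apply: xmin; rewrite inE; exact: AP.
apply: le_trans gt; have := kE (fun=> 1) (fun=> 1) (fun=> 0) one1.
rewrite udiag_scalar mul1mx => ->; apply: xmin; rewrite inE.
by apply: AP => //; rewrite udiag_scalar mul1mx.
Qed.

End Minimum.

Theorem theorem3p8 (K : realType) (n : nat) (n_gt0 : (0 < n)%N)
    (R : 'M[K]_(twon n))
    (R_unit : R \in unitmx) (R_upper : upper_triangular R)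
    (s : 'I_n -> bool) :
  exists m : K,
    [/\ (exists2 D, calD D & kappa2 (D *m R) = m),
        (forall D, calD D -> m <= kappa2 (D *m R)),
        m <= kappa2 (Dtilde R s *m R) &
        kappa2 (Dtilde R s *m R) <=
          Num.sqrt (2 * n)%:R
          * (beta R * Num.sqrt (beta R ^+ 2
               + Num.sqrt (beta R ^+ 4 - gamma R ^+ 4)) / gamma R ^+ 2)
          * m].
Proof.
have [D DD Dmin] := exists_min_kappa2 R R_unit.
exists (kappa2 (D *m R)); split=> //.
- by exists D.
- by apply: Dmin; exact: Dtilde_calD.
- exact: kappa2_Dtilde_le.
Qed.
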